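(* For every $t\in(0,4)\setminus\{1,2,3\}$ there is a constant $c_t>0$ such that $$c_t^{-1}\,\mathcal{H}^t_\infty\bigl(\overline R(p,r)\bigr)\ \le\ \Phi^t(r)\ \le\ c_t\,\mathrm{Cap}_t\bigl(\overline R(p,r)\bigr)$$ for every $p\in\mathbf{H}$ and every pair $r=(r_1,r_2)$ of positive real numbers, where Hausdorff content and capacity are taken in the metric space $(\mathbf{H},d_{\mathbf H})$.
   Context: The Heisenberg group $\mathbf{H}$ is the set $\mathbf{R}^3$ with group operation $pp'=(x+x',\,y+y',\,z+z'+2(xy'-yx'))$ for $p=(x,y,z)$, $p'=(x',y',z')$. It carries the left-invariant metric $d_{\mathbf H}(p,p')=\|p^{-1}p'\|$, where $\|(x,y,z)\|=((x^2+y^2)^2+z^2)^{1/4}$ and $p^{-1}=(-x,-y,-z)$. For $p=(x,y,z)\in\mathbf{H}$ and a pair $r=(r_1,r_2)$ of positive numbers, the closed rectangle centred at $p$ is $$\overline R(p,r)=\{(x',y',z');\ (x'-x)^2+(y'-y)^2\le r_1^2,\ |z'-z-2(xy'-yx')|\le r_2^2\},$$ which equals $p\,\overline R(0,r)$. The directed singular value function $\Phi^t(r)$, for $t\in[0,4]$ and $r=(r_1,r_2)$ with $r_1,r_2>0$, is defined as follows. If $r_1\le r_2$: $\Phi^t(r)=r_2^t$ for $t\in[0,2]$ and $\Phi^t(r)=r_1^{t-2}r_2^2$ for $t\in[2,4]$. If $r_1\ge r_2$: $\Phi^t(r)=r_1^t$ for $t\in[0,3]$ and $\Phi^t(r)=r_1^{6-t}r_2^{2(t-3)}$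 for $t\in[3,4]$. For a subset $A$ of a metric space $X$, the $t$-dimensional Hausdorff content is $\mathcal{H}^t_\infty(A)=\inf\{\sum_n|C_n|^t;\ \{C_n\}\text{ is a countable cover of }A\}$, where $|C|$ denotes the diameter of $C$. For a Borel measure $\mu$ on $X$ and $t>0$, the $t$-energy is $I_t(\mu)=\iint d(x,y)^{-t}\,d\mu(y)\,d\mu(x)$ (with $d(x,x)^{-t}=\infty$). For a Borel set $A\subset X$, $\mathrm{Cap}_t(A)=\sup\{1/I_t(\mu);\ \mu\in\mathcal P(A)\}$, where $\mathcal P(A)$ is the set of Borel probability measures on $X$ giving full measure to $A$, and $1/\infty=0$. *)

(* Defs.v *)
From HB Require Import structures.
From mathcomp Require Import all_boot all_order all_algebra.
From mathcomp Require Import all_classical all_reals all_analysis.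
From mathcomp Require Import ring lra.

Set Implicit Arguments.
Unset Strict Implicit.
Unset Printing Implicit Defensive.

Import Order.TTheory GRing.Theory Num.Theory.
Import numFieldNormedType.Exports.

Local Open Scope classical_set_scope.
Local Open Scope ring_scope.

#[short(type="pointedMetricType")]
HB.structure Definition PointedMetric (K : numDomainType) :=
  { M of Metric K M & Pointed M }.

Notation borelType X := (@g_sigma_algebraType X open).

Section metric_space.
Context {R : realType} {X : pointedMetricType R}.
Implicit Types (A C : set X) (t : R).

Local Open Scope ereal_scope.

(* 0 is thrown in so that the empty set has diameter 0 rather than -oo. *)
Definition diameter C : \bar R :=
  ereal_sup (0 |` [set (mdist x y)%:E | x in C & y in C]).

(* Since the empty set has diameter 0, for t > 0 the covers by sequences
   also account for the finite covers. *)
Definition hausdorff_content t A : \bar R :=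
  ereal_inf [set \sum_(0 <= n <oo) diameter (C n) `^ t
            | C in [set C : nat -> set X | A `<=` \bigcup_n C n]].

(* The power is inverted in \bar R, where 0^-1 = +oo; in contrast
   0 `^ (- t) = 0 in R. *)
Definition energy t (mu : {measure set (borelType X) -> \bar R}) : \bar R :=
  \int[mu]_x \int[mu]_y ((mdist (x : X) (y : X) `^ t)%R%:E)^-1.

(* The index set is empty, and the supremum -oo, only when A is empty. *)
Definition capacity t A : \bar R :=
  ereal_sup [set (energy t mu)^-1
            | mu in [set mu : probability (borelType X) R | mu A = 1]].

End metric_space.

Record heisenberg (R : realType) := Heisenberg { xcoord : R ; ycoord : R ; zcoord : R }.

Section heisenberg_group.
Context {R : realType}.
Local Notation H := (heisenberg R).
Implicit Types p q : H.

Definition heisenberg_triple p : R * R * R := (xcoord p, ycoord p, zcoord p).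
Definition triple_heisenberg (u : R * R * R) : H :=
  Heisenberg u.1.1 u.1.2 u.2.

Lemma heisenberg_tripleK : cancel heisenberg_triple triple_heisenberg.
Proof. by case. Qed.

HB.instance Definition _ := Choice.copy H (can_type heisenberg_tripleK).
HB.instance Definition _ := isPointed.Build H (Heisenberg 0 0 0).

Definition heisenberg_one : H := Heisenberg 0 0 0.

Definition heisenberg_inv p : H := Heisenberg (- xcoord p) (- ycoord p) (- zcoord p).

Definition heisenberg_mul p q : H :=
  Heisenberg (xcoord p + xcoord q) (ycoord p + ycoord q)
             (zcoord p + zcoord q + 2 * (xcoord p * ycoord q - ycoord p * xcoord q)).

Lemma heisenberg_mulA : associative heisenberg_mul.
Proof.
by move=> [x y z] [x' y' z'] [a b c]; congr Heisenberg; rewrite /=; ring.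
Qed.

Lemma heisenberg_mul1 : left_id heisenberg_one heisenberg_mul.
Proof. by move=> [x y z]; congr Heisenberg; rewrite /=; ring. Qed.

Lemma heisenberg_mul1r : right_id heisenberg_one heisenberg_mul.
Proof. by move=> [x y z]; congr Heisenberg; rewrite /=; ring. Qed.

Lemma heisenberg_mulV :
  left_inverse heisenberg_one heisenberg_inv heisenberg_mul.
Proof. by move=> [x y z]; congr Heisenberg; rewrite /=; ring. Qed.

Lemma heisenberg_mulVr :
  right_inverse heisenberg_one heisenberg_inv heisenberg_mul.
Proof. by move=> [x y z]; congr Heisenberg; rewrite /=; ring. Qed.

HB.instance Definition _ := isGroup.Build H heisenberg_mulA heisenberg_mul1
  heisenberg_mul1r heisenberg_mulV heisenberg_mulVr.

Definition hnorm p : R :=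
  ((xcoord p ^+ 2 + ycoord p ^+ 2) ^+ 2 + zcoord p ^+ 2) `^ 4^-1.

Definition hdist p q : R := hnorm (p^-1 * q)%g.

Lemma hnorm_ge0 p : 0 <= hnorm p.
Proof. exact: powR_ge0. Qed.

Lemma hnorm4 p : hnorm p ^+ 4 = (xcoord p ^+ 2 + ycoord p ^+ 2) ^+ 2 + zcoord p ^+ 2.
Proof.
rewrite /hnorm -powR_mulrn ?powR_ge0// -powRrM mulVf ?powRr1//.
by rewrite addr_ge0 ?sqr_ge0.
Qed.

Lemma hnormV p : hnorm (p^-1)%g = hnorm p.
Proof. by rewrite /hnorm /= !sqrrN. Qed.

Lemma hnorm_eq0 p : hnorm p = 0 -> p = 1%g.
Proof.
move=> p0; have := hnorm4 p; rewrite p0 expr0n /= => /esym/eqP.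
rewrite paddr_eq0 ?sqr_ge0// !sqrf_eq0 paddr_eq0 ?sqr_ge0// !sqrf_eq0.
by case: p {p0} => x y z /= /andP[/andP[/eqP-> /eqP->] /eqP->].
Qed.

Lemma minkowski2 (a b c d A B : R) : 0 <= A -> 0 <= B ->
  a ^+ 2 + b ^+ 2 <= A ^+ 2 -> c ^+ 2 + d ^+ 2 <= B ^+ 2 ->
  (a + c) ^+ 2 + (b + d) ^+ 2 <= (A + B) ^+ 2.
Proof.
move=> A0 B0 abA cdB; have abcd : a * c + b * d <= A * B.
  apply: (le_trans (ler_norm _)); rewrite -ler_sqr ?nnegrE ?mulr_ge0//.
  rewrite real_normK ?num_real// exprMn.
  have : (a ^+ 2 + b ^+ 2) * (c ^+ 2 + d ^+ 2) <= A ^+ 2 * B ^+ 2.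
    by apply: ler_pM; rewrite ?addr_ge0 ?sqr_ge0.
  by have := sqr_ge0 (a * d - b * c); nra.
by rewrite !sqrrD; lra.
Qed.

Lemma hnormM p q : hnorm (p * q)%g <= hnorm p + hnorm q.
Proof.
have [p0 q0] := (hnorm_ge0 p, hnorm_ge0 q).
rewrite -(@ler_pXn2r _ 4) ?nnegrE ?addr_ge0 ?hnorm_ge0//.
have := hnorm4 (p * q)%g => ->; move: (hnorm4 p) (hnorm4 q) p0 q0.
move: (hnorm p) (hnorm q) => m n; case: p q => [x y z] [x' y' z'] /=.
move=> m4 n4 m0 n0; have m20 := sqr_ge0 m; have n20 := sqr_ge0 n.
have xym : x ^+ 2 + y ^+ 2 <= m ^+ 2.
  rewrite -ler_sqr ?nnegrE ?addr_ge0 ?sqr_ge0//.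
  by rewrite -(exprM m 2 2) m4 lerDl sqr_ge0.
have xyn : x' ^+ 2 + y' ^+ 2 <= n ^+ 2.
  rewrite -ler_sqr ?nnegrE ?addr_ge0 ?sqr_ge0//.
  by rewrite -(exprM n 2 2) n4 lerDl sqr_ge0.
have su : (2 * (x * x' + y * y')) ^+ 2 + (2 * (x * y' - y * x')) ^+ 2
    <= (2 * m * n) ^+ 2.
  have : (x ^+ 2 + y ^+ 2) * (x' ^+ 2 + y' ^+ 2) <= m ^+ 2 * n ^+ 2.
    by apply: ler_pM; rewrite ?addr_ge0 ?sqr_ge0.
  by nra.
have abz : ((x ^+ 2 + y ^+ 2) + (x' ^+ 2 + y' ^+ 2)) ^+ 2 + (z + z') ^+ 2
    <= (m ^+ 2 + n ^+ 2) ^+ 2.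
  by apply: minkowski2 => //; rewrite -exprM ?m4 ?n4.
have := minkowski2 (addr_ge0 m20 n20) (mulr_ge0 (mulr_ge0 (ler0n _ 2) m0) n0) abz su.
rewrite (_ : (m + n) ^+ 4 = (m ^+ 2 + n ^+ 2 + 2 * m * n) ^+ 2); last by ring.
apply: le_trans; rewrite le_eqVlt; apply/orP; left; apply/eqP; ring.
Qed.

Lemma hdistxx p : hdist p p = 0.
Proof.
rewrite /hdist mulVg /hnorm /= (_ : _ + _ = 0); last by ring.
by rewrite powR0 ?invr_eq0.
Qed.

Lemma hdist_positivity p q : hdist p q = 0 -> p = q.
Proof. by move=> /hnorm_eq0/(congr1 (fun s => p * s)%g); rewrite mulVKg mulg1. Qed.

Lemma hdist_sym p q : hdist p q = hdist q p.
Proof. by rewrite /hdist -hnormV invgM invgK. Qed.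

Lemma hdist_triangle q p s : hdist p s <= hdist p q + hdist q s.
Proof.
rewrite /hdist; apply: le_trans (hnormM _ _).
by rewrite -mulgA mulVKg.
Qed.

HB.instance Definition _ :=
  isMetric.Build R H hdistxx hdist_positivity hdist_sym hdist_triangle.

Definition closed_rectangle p (r : R * R) : set H :=
  [set q | (xcoord q - xcoord p) ^+ 2 + (ycoord q - ycoord p) ^+ 2 <= r.1 ^+ 2 /\
           `|zcoord q - zcoord p - 2 * (xcoord p * ycoord q - ycoord p * xcoord q)| <= r.2 ^+ 2].

Lemma closed_rectangleE p r :
  closed_rectangle p r = [set (p * q)%g | q in closed_rectangle 1%g r].
Proof.
have E q : closed_rectangle p r (p * q)%g <-> closed_rectangle 1%g r q.
  case: p q => [x y z] [x' y' z']; rewrite /closed_rectangle /=.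
  by split=> -[h1 h2]; split;
    [move: h1 | move: h2 | move: h1 | move: h2]; apply: eq_ind;
    congr (_ <= _); try congr (`|_|); ring.
apply/seteqP; split=> [q rq|_ [q rq <-]]; last exact/E.
by exists (p^-1 * q)%g; [apply/E; rewrite mulVKg | rewrite mulVKg].
Qed.

End heisenberg_group.

(* Only meaningful for 0 <= t <= 4 and 0 < r.1, 0 < r.2. *)
Definition directed_singular_value {R : realType} (t : R) (r : R * R) : R :=
  if r.1 <= r.2 then
    if t <= 2 then r.2 `^ t else r.1 `^ (t - 2) * r.2 ^+ 2
  else
    if t <= 3 then r.1 `^ t else r.1 `^ (6 - t) * r.2 `^ (2 * (t - 3)).

(* Main.v *)
Require Import Defs.
From HB Require Import structures.
From mathcomp Require Import all_boot all_order all_algebra.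
From mathcomp Require Import all_classical all_reals all_analysis.
From mathcomp Require Import measurable_realfun ring lra.

Set Implicit Arguments.
Unset Strict Implicit.
Unset Printing Implicit Defensive.

Import Order.TTheory GRing.Theory Num.Theory.
Local Open Scope classical_set_scope.
Local Open Scope ring_scope.

(** For each [t] a rectangle has a scale [d] and a number [W] such that, up to
    constants, it is covered by [W] balls of radius [d] and carries a
    probability measure giving at most [1 / W] to every such ball.  In all four
    regimes of the directed singular value function
    [directed_singular_value t r = W * d `^ t]:
    - [r.1 <= r.2], [t < 2]: one ball covers, [d = r.2] and [W = 1];
    - [r.1 <= r.2], [2 < t]: the rectangle is a column of balls of radius
      [d = r.1], and [W = r.2 ^+ 2 / r.1 ^+ 2];
    - [r.2 < r.1], [t < 3]: again one ball covers, [d = r.1] and [W = 1];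
    - [r.2 < r.1], [3 < t]: the scale is [d = r.2 ^+ 2 / r.1], the radius below
      which the twist of the group law across a ball no longer exceeds the
      thickness of the rectangle, and [W = (r.1 / r.2) ^+ 6].

    The bound on the content is then the count of balls of a cover
    ([hausdorff_content_rectangle_le]): a grid of step [d] in the
    first two coordinates and [d ^+ 2] in the third, where the twist enlarges
    the vertical extent from [r.2 ^+ 2] to at most [r.2 ^+ 2 + 4 * r.1 * d].

    The bound on the capacity uses one probability measure for all regimes,
    the image [rectangle_prob] of the uniform measure of the unit cube under a
    chart [(x, m, z) |-> (x, m * x, z)], whose first coordinate is kept away
    from [0].  A ball of radius [s] has measure at most a constant times each
    of [1], [s ^+ 2 / r.2 ^+ 2], [s ^+ 3 / r.1 ^+ 3] and
    [s ^+ 4 / (r.1 ^+ 2 * r.2 ^+ 2)].  In each regime two of these bounds, with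
    exponents [a] and [b] such that [b < t < a], cross at the scale [d], where
    they are of order [1 / W].  Summing [s `^ (- t)] times the measure of the
    balls over dyadic [s], with the exponent [a] below [d] and [b] above,
    shows that the potential of the measure is everywhere at most of
    order [1 / (W * d `^ t)] ([potential_le]), hence so is its energy. *)

(** * Potentials and energies in a metric space *)

(** The integral of a nonnegative function is a supremum over the simple
    functions below it, so monotonicity holds without measurability; this
    avoids proving that potentials are measurable functions of their pole. *)
Lemma le_ge0_integral d (T : measurableType d) (R : realType)
    (mu : {measure set T -> \bar R}) (f g : T -> \bar R) :
  (forall x, 0 <= f x)%E -> (forall x, f x <= g x)%E ->
  (\int[mu]_x f x <= \int[mu]_x g x)%E.
Proof.
move=> f0 fg; have g0 x : (0 <= g x)%E := le_trans (f0 x) (fg x).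
rewrite !ge0_integralTE//; apply: le_ereal_sup => _ [h /= hf <-].
by exists h => // x; exact: le_trans (hf x) (fg x).
Qed.

Lemma exp2_bracket (R : realType) (u : R) : 1 <= u ->
  exists n : nat, 2 ^+ n <= u < 2 ^+ n.+1.
Proof.
move=> u1; have /ex_minnP[m um mmin] : exists n : nat, u < 2 ^+ n.+1.
  exists (Num.truncn u); apply: lt_trans (truncnS_gt u) _.
  by rewrite -natrX ltr_nat ltn_expl.
exists m; rewrite um andbT; case: m mmin {um} => [//|m mmin].
by rewrite leNgt; apply/negP => /mmin; rewrite ltnn.
Qed.

Lemma sum_geometric_le (R : realType) (C q : R) : 0 <= C -> 0 <= q < 1 ->
  (\sum_(0 <= k <oo) (C * q ^+ k)%:E <= (C / (1 - q))%:E)%E.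
Proof.
move=> C0 /andP[q0 q1]; apply: lime_le.
  by apply: is_cvg_nneseries => n _ _; rewrite lee_fin mulr_ge0// exprn_ge0.
apply: nearW => n; rewrite sumEFin lee_fin -mulr_sumr ler_wpM2l//.
rewrite -[leRHS]div1r ler_pdivlMr ?subr_gt0//.
suff -> : (\sum_(0 <= i < n) q ^+ i) * (1 - q) = 1 - q ^+ n.
  by rewrite lerBlDr lerDl exprn_ge0.
elim: n => [|n ih]; first by rewrite big_geq// mul0r expr0 subrr.
by rewrite big_nat_recr//= mulrDl ih exprSr; ring.
Qed.

Lemma powRX (R : realType) (x t : R) n : 0 <= x ->
  (x ^+ n) `^ t = (x `^ t) ^+ n.
Proof.
move=> x0; rewrite -powR_mulrn// -powRrM mulrC powRrM powR_mulrn//.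
exact: powR_ge0.
Qed.

Lemma ltr_powR2 (R : realType) (s t : R) : s < t -> 2 `^ s < 2 `^ t.
Proof.
move=> st; rewrite -(subrK s t) powRD ?pnatr_eq0 ?implybT//.
rewrite ltr_pMl ?powR_gt0//.
apply: (@le_lt_trans _ _ (1 `^ (t - s))); first by rewrite powR1.
by rewrite gt0_ltr_powR ?nnegrE ?subr_gt0// ltr1n.
Qed.

Lemma ltr_powR2X (R : realType) (t : R) n : t < n%:R -> 2 `^ t < 2 ^+ n.
Proof. by rewrite -powR_mulrn//; exact: ltr_powR2. Qed.

Lemma ltr_X_powR2 (R : realType) (t : R) n : n%:R < t -> 2 ^+ n < 2 `^ t.
Proof. by rewrite -powR_mulrn//; exact: ltr_powR2. Qed.

Lemma le_term_nneseries (R : realType) (u : nat -> \bar R) n :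
  (forall k, 0 <= u k)%E -> (u n <= \sum_(0 <= k <oo) u k)%E.
Proof.
by move=> u0; rewrite (@nneseriesD1 _ u n xpredT)// leeDl// nneseries_ge0.
Qed.

Section potential.
Context {R : realType} {X : pointedMetricType R}.

Definition potential (t : R) (mu : {measure set (borelType X) -> \bar R})
    (x : X) : \bar R := (\int[mu]_y ((mdist x (y : X) `^ t)%R%:E)^-1)%E.

Definition closed_mball (x : X) (s : R) : set X := [set y | mdist x y <= s].

Lemma measurable_closed_mball (x : X) (s : R) :
  measurable (closed_mball x s : set (borelType X)).
Proof.
rewrite -[closed_mball x s]setCK; apply: measurableC; apply: sub_gen_smallest.
rewrite openE => y /= /negP; rewrite -ltNge => sxy.
rewrite /interior; apply/nbhs_ballP.
exists (mdist x y - s) => /=; first by rewrite subr_gt0.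
move=> z; rewrite ballEmdist /= => yz; apply/negP; rewrite -ltNge.
by have := metric_triangle x z y; rewrite (metric_sym z y); lra.
Qed.

(** The two families of balls are meant for the small and the large
    distances. *)
Lemma potential_le_series (t : R) (mu : {measure set (borelType X) -> \bar R})
    (x : X) (s s' c c' : nat -> R) :
  (forall n, 0 <= c n) -> (forall n, 0 <= c' n) ->
  (forall y : X, (mdist x y `^ t)%:E^-1 <= \sum_(0 <= n <oo)
    (c n * \1_(closed_mball x (s n)) y + c' n * \1_(closed_mball x (s' n)) y)%:E)%E ->
  (potential t mu x <= \sum_(0 <= n <oo)
    ((c n)%:E * mu (closed_mball x (s n)) + (c' n)%:E * mu (closed_mball x (s' n))))%E.
Proof.
move=> c0 c'0 fle; apply: le_trans (le_ge0_integral mu _ fle) _.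
  by move=> y; rewrite inve_ge0 lee_fin powR_ge0.
have mB r : measurable_fun [set: borelType X] (\1_(closed_mball x r) : _ -> R).
  by apply: measurable_indic; exact: measurable_closed_mball.
rewrite integral_nneseries//=; last 2 first.
- by move=> n; apply/measurable_EFinP; apply: measurable_funD;
    apply: measurable_funM.
- by move=> n y _; rewrite lee_fin addr_ge0// mulr_ge0.
apply: lee_nneseries => [n _ _|n _].
  by apply: integral_ge0 => y _; rewrite lee_fin addr_ge0// mulr_ge0.
under eq_integral do rewrite EFinD !EFinM.
rewrite ge0_integralD//; last 4 first.
- by move=> y _; rewrite -EFinM lee_fin mulr_ge0.
- by apply/measurable_EFinP; apply: measurable_funM.
- by move=> y _; rewrite -EFinM lee_fin mulr_ge0.
- by apply/measurable_EFinP; apply: measurable_funM.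
rewrite !ge0_integralZl//; try by [rewrite lee_fin | apply/measurable_EFinP].
by rewrite !integral_indic ?setIT//; exact: measurable_closed_mball.
Qed.

(** The two geometric series that arise from summing the bound
    [K1 * s ^+ a] over [s = d / 2 ^+ n] and [K2 * s ^+ b] over
    [s = d * 2 ^+ n.+1]. *)
Definition scale_constant (t : R) (a b : nat) : R :=
  2 `^ t / (1 - 2 `^ t / 2 ^+ a) + 2 ^+ b / (1 - 2 ^+ b / 2 `^ t).

Lemma scale_constant_gt0 (t : R) (a b : nat) : b%:R < t -> t < a%:R ->
  0 < scale_constant t a b.
Proof.
move=> bt ta; rewrite addr_gt0//.
  by rewrite divr_gt0 ?powR_gt0// subr_gt0 ltr_pdivrMr ?exprn_gt0// mul1r ltr_powR2X.
by rewrite divr_gt0 ?exprn_gt0// subr_gt0 ltr_pdivrMr ?powR_gt0// mul1r ltr_X_powR2.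
Qed.

(** The kernel [mdist x y `^ (- t)] is bounded by the series of the
    indicators of the balls of radii [d / 2 ^+ n] and [d * 2 ^+ n.+1], weighted
    by its value at half the radius; the measure of the ball of radius [s] is
    at most [K1 * s ^+ a] at small scales and [K2 * s ^+ b] at large ones, and
    [b < t < a] makes both series geometric. *)
Lemma potential_le (t : R) (a b : nat)
    (mu : {measure set (borelType X) -> \bar R}) (x : X) (d K1 K2 : R) :
  0 < t -> b%:R < t -> t < a%:R -> 0 < d -> 0 <= K1 -> 0 <= K2 ->
  (forall s, 0 < s -> (mu (closed_mball x s) <= (K1 * s ^+ a)%:E)%E) ->
  (forall s, 0 < s -> (mu (closed_mball x s) <= (K2 * s ^+ b)%:E)%E) ->
  (potential t mu x <=
    (scale_constant t a b * (K1 * d ^+ a + K2 * d ^+ b) / d `^ t)%:E)%E.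
Proof.
move=> t0 bt ta d0 K10 K20 muK1 muK2.
set T := 2 `^ t; set D := d `^ t.
have T0 : 0 < T by rewrite powR_gt0.
have D0 : 0 < D by rewrite powR_gt0.
have Ta : T < 2 ^+ a by rewrite ltr_powR2X.
have bT : 2 ^+ b < T by rewrite ltr_X_powR2.
pose c n := T ^+ n.+1 / D; pose c' n := (D * T ^+ n)^-1.
have c0 n : 0 <= c n by rewrite ltW// divr_gt0// exprn_gt0.
have c'0 n : 0 <= c' n by rewrite ltW// invr_gt0 mulr_gt0// exprn_gt0.
have powT n : (2 ^+ n) `^ t = T ^+ n by rewrite powRX.
apply: (@le_trans _ _ (\sum_(0 <= n <oo)
    ((c n)%:E * mu (closed_mball x (d / 2 ^+ n)) +
     (c' n)%:E * mu (closed_mball x (d * 2 ^+ n.+1))))%E).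
  apply: potential_le_series => // y.
  have term_le n : ((c n * \1_(closed_mball x (d / 2 ^+ n)) y +
      c' n * \1_(closed_mball x (d * 2 ^+ n.+1)) y)%:E <= \sum_(0 <= n <oo)
      (c n * \1_(closed_mball x (d / 2 ^+ n)) y +
       c' n * \1_(closed_mball x (d * 2 ^+ n.+1)) y)%:E)%E.
    by apply: le_term_nneseries => m; rewrite lee_fin addr_ge0// mulr_ge0.
  have [xy0|xy0] := eqVneq (mdist x y) 0.
    (* At the pole the kernel is infinite, and so is the series: its terms are
       unbounded. *)
    rewrite xy0 powR0 ?gt_eqF// inve0 leye_eq; apply/eqP/eqyP => M M0.
    pose n := Num.truncn ((M * D) `^ t^-1).
    apply: le_trans (term_le n); rewrite lee_fin.
    rewrite indicE mem_set ?mulr1; last first.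
      by rewrite /closed_mball/= xy0 ltW// divr_gt0// exprn_gt0.
    rewrite ler_wpDr ?(mulr_ge0 (c'0 n))// ler_pdivlMr// -powT.
    have MD : M * D = ((M * D) `^ t^-1) `^ t.
      by rewrite -powRrM mulVf ?gt_eqF// powRr1// mulr_ge0// ltW.
    rewrite MD ge0_ler_powR ?nnegrE ?powR_ge0 ?exprn_ge0//; first exact: ltW.
    apply: le_trans (ltW (truncnS_gt _)) _.
    by rewrite -natrX ler_nat ltnW// ltn_expl.
  have xy : 0 < mdist x y by rewrite lt_def xy0 mdist_ge0.
  rewrite inver gt_eqF ?powR_gt0//.
  have [dxy|xyd] := leP d (mdist x y).
    have [|n /andP[n1 n2]] := @exp2_bracket _ (mdist x y / d).
      by rewrite ler_pdivlMr// mul1r.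
    rewrite ler_pdivlMr// in n1; rewrite ltr_pdivrMr// in n2.
    apply: le_trans (term_le n); rewrite lee_fin.
    rewrite [X in _ + c' n * X]indicE mem_set ?mulr1; last first.
      by rewrite /closed_mball/= mulrC ltW.
    rewrite ler_wpDl ?(mulr_ge0 (c0 n))// /c' lef_pV2 ?posrE ?mulr_gt0 ?exprn_gt0 ?powR_gt0//.
    rewrite -powT mulrC -powRM ?exprn_ge0 ?(ltW d0)//.
    by rewrite ge0_ler_powR ?nnegrE ?mulr_ge0 ?exprn_ge0 ?mdist_ge0 ?(ltW t0) ?(ltW n2) ?(ltW d0).
  have [|n /andP[n1 n2]] := @exp2_bracket _ (d / mdist x y).
    by rewrite ler_pdivlMr// mul1r ltW.
  rewrite ler_pdivlMr// in n1; rewrite ltr_pdivrMr// in n2.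
  apply: le_trans (term_le n); rewrite lee_fin.
  rewrite [X in c n * X]indicE mem_set ?mulr1; last first.
    by rewrite /closed_mball/= ler_pdivlMr ?exprn_gt0// mulrC.
  rewrite ler_wpDr ?(mulr_ge0 (c'0 n))// ler_pdivlMr// mulrC ler_pdivrMr ?powR_gt0//.
  rewrite -powT -powRM ?exprn_ge0 ?mdist_ge0//.
  by rewrite ge0_ler_powR ?nnegrE ?mulr_ge0 ?exprn_ge0 ?mdist_ge0 ?(ltW t0) ?(ltW n2) ?(ltW d0).
pose q := T / 2 ^+ a; pose q' := 2 ^+ b / T.
have q01 : 0 <= q < 1.
  by rewrite divr_ge0 ?exprn_ge0 ?(ltW T0)//= ltr_pdivrMr ?exprn_gt0// mul1r.
have q'01 : 0 <= q' < 1.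
  by rewrite divr_ge0 ?exprn_ge0 ?(ltW T0)//= ltr_pdivrMr// mul1r.
pose A := T / D * (K1 * d ^+ a); pose B := 2 ^+ b / D * (K2 * d ^+ b).
have A0 : 0 <= A by rewrite !mulr_ge0 ?invr_ge0 ?exprn_ge0// ltW.
have B0 : 0 <= B by rewrite !mulr_ge0 ?invr_ge0 ?exprn_ge0// ltW.
have [/andP[q0 q1] /andP[q'0 q'1]] := (q01, q'01).
apply: (@le_trans _ _ (\sum_(0 <= n <oo) ((A * q ^+ n)%:E + (B * q' ^+ n)%:E))%E).
  apply: lee_nneseries => [n _ _|n _].
    by rewrite adde_ge0 ?mule_ge0 ?lee_fin.
  apply: leeD.
    have -> : A * q ^+ n = c n * (K1 * (d / 2 ^+ n) ^+ a).
      rewrite /A /c /q !expr_div_n exprS -!exprM mulnC; field.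
      by rewrite !gt_eqF ?exprn_gt0.
    rewrite [leRHS]EFinM; apply: lee_wpmul2l; first by rewrite lee_fin.
    by apply: muK1; rewrite divr_gt0// exprn_gt0.
  have -> : B * q' ^+ n = c' n * (K2 * (d * 2 ^+ n.+1) ^+ b).
    rewrite /B /c' /q' !exprMn exprVn -!exprM [(n.+1 * b)%N]mulSn exprD mulnC.
    by field; rewrite !gt_eqF ?exprn_gt0.
  rewrite [leRHS]EFinM; apply: lee_wpmul2l; first by rewrite lee_fin.
  by apply: muK2; rewrite mulr_gt0// exprn_gt0.
rewrite nneseriesD; try by move=> n _ _; rewrite lee_fin mulr_ge0// exprn_ge0.
apply: le_trans (leeD (sum_geometric_le A0 q01) (sum_geometric_le B0 q'01)) _.
rewrite -EFinD lee_fin /scale_constant -/T -/q -/q'.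
have Dq : 0 <= (1 - q)^-1 by rewrite invr_ge0 subr_ge0 ltW.
have Dq' : 0 <= (1 - q')^-1 by rewrite invr_ge0 subr_ge0 ltW.
have -> : (T / (1 - q) + 2 ^+ b / (1 - q')) * (K1 * d ^+ a + K2 * d ^+ b) / D =
    A / (1 - q) + B / (1 - q') +
    (T / (1 - q) / D * (K2 * d ^+ b) + 2 ^+ b / (1 - q') / D * (K1 * d ^+ a)).
  by rewrite /A /B; ring.
rewrite lerDl; move: (exprn_ge0 a (ltW d0)) (exprn_ge0 b (ltW d0)) => ? ?.
have D'0 : 0 <= D^-1 by rewrite invr_ge0 ltW.
by apply: addr_ge0; do !apply: mulr_ge0 => //; rewrite ?exprn_ge0 ?(ltW T0).
Qed.

(** The potential is bounded at every point of the space, not only on [A], so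
    the energy is bounded by integrating a constant. *)
Lemma capacity_ge (t : R) (a b : nat) (mu : probability (borelType X) R)
    (A : set X) (d K1 K2 : R) :
  0 < t -> b%:R < t -> t < a%:R -> 0 < d -> 0 < K1 -> 0 < K2 -> mu A = 1%E ->
  (forall x s, 0 < s -> (mu (closed_mball x s) <= (K1 * s ^+ a)%:E)%E) ->
  (forall x s, 0 < s -> (mu (closed_mball x s) <= (K2 * s ^+ b)%:E)%E) ->
  ((d `^ t / (scale_constant t a b * (K1 * d ^+ a + K2 * d ^+ b)))%:E
     <= capacity t A)%E.
Proof.
move=> t0 bt ta d0 K10 K20 muA muK1 muK2.
have C0 := scale_constant_gt0 bt ta.
set S := _ * (_ + _); have S0 : 0 < S.
  by rewrite mulr_gt0// addr_gt0// mulr_gt0// exprn_gt0.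
have D0 : 0 < d `^ t by rewrite powR_gt0.
apply: (@le_trans _ _ (energy t mu)^-1%E); last first.
  by apply: ereal_sup_ubound; exists mu.
have energy_ge0 : (0 <= energy t mu)%E.
  apply: integral_ge0 => x _; apply: integral_ge0 => y _.
  by rewrite inve_ge0 lee_fin powR_ge0.
rewrite inve_pge ?inE//; last by rewrite lee_fin ltW// divr_gt0.
rewrite inver gt_eqF ?divr_gt0// invf_div.
apply: le_trans (_ : (\int[mu]_x (S / d `^ t)%:E <= _)%E).
  apply: le_ge0_integral => x.
    by apply: integral_ge0 => y _; rewrite inve_ge0 lee_fin powR_ge0.
  by apply: potential_le => //; [exact: ltW|exact: ltW|exact: muK1|exact: muK2].
rewrite integral_cst// [X in (_ * X)%E](_ : _ = 1%E) ?mule1//.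
exact: probability_setT.
Qed.

End potential.

(** * Hausdorff content of a finite union *)

Section content.
Context {R : realType} {X : pointedMetricType R}.

Lemma diameter_ge0 (C : set X) : (0 <= diameter C)%E.
Proof. by apply: ereal_sup_ubound; left. Qed.

Lemma diameter_le (C : set X) (D : R) : 0 <= D ->
  (forall x y, C x -> C y -> mdist x y <= D) -> (diameter C <= D%:E)%E.
Proof.
move=> D0 CD; apply: ge_ereal_sup => _ [->|[y Cy [z Cz <-]]]; rewrite lee_fin//.
exact: CD.
Qed.

Lemma diameter_closed_mball (x : X) (s : R) : 0 <= s ->
  (diameter (closed_mball x s) <= (2 * s)%:E)%E.
Proof.
move=> s0; apply: diameter_le => [|y z xy xz]; first by rewrite mulr_ge0.
apply: le_trans (metric_triangle y x z) _; rewrite (metric_sym y).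
by move: xy xz; rewrite /closed_mball/=; lra.
Qed.

(** The finite cover is completed to a sequence by empty sets, of diameter
    [0]. *)
Lemma hausdorff_content_le (t D : R) (A : set X) (I : finType)
    (B : I -> set X) :
  0 < t -> A `<=` \bigcup_i B i -> (forall i, (diameter (B i) <= D%:E)%E) ->
  (hausdorff_content t A <= (#|I|%:R * D `^ t)%:E)%E.
Proof.
move=> t0 AB BD.
pose C n := if insub n is Some i then B (enum_val (i : 'I_#|I|)) else set0.
apply: (@le_trans _ _ (\sum_(0 <= n <oo) diameter (C n) `^ t)%E).
  apply: ereal_inf_lbound; exists C => // x /AB[i _ Bix].
  by exists (enum_rank i) => //; rewrite /C valK enum_rankK.
rewrite (nneseries_split 0 #|I|); last by move=> n _; exact: poweR_ge0.
rewrite add0n [X in (_ + X)%E]eseries0 ?adde0; last first.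
  move=> n In _; rewrite /C insubF; last by rewrite ltnNge In.
  suff -> : diameter (set0 : set X) = 0%E by rewrite poweR0r// gt_eqF.
  by apply/le_anti; rewrite diameter_ge0 diameter_le.
rewrite big_mkord; apply: (@le_trans _ _ (\sum_(n < #|I|) (D `^ t)%:E)%E).
  apply: lee_sum => n _; rewrite -poweR_EFin.
  have CnD : (diameter (C n) <= D%:E)%E by rewrite /C valK; exact: BD.
  apply: gt0_ler_poweR; rewrite ?in_itv/= ?leey ?andbT ?diameter_ge0 ?(ltW t0) ?CnD//.
  exact: le_trans (diameter_ge0 (C n)) CnD.
by rewrite sumEFin sumr_const card_ord mulr_natl.
Qed.

End content.

(** * Covers of rectangles by balls *)

Section heisenberg_cover.
Context {R : realType}.
Local Notation H := (heisenberg R).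
Implicit Types p q g : H.

Lemma mdist_mul2l g p q : mdist (g * p)%g (g * q)%g = mdist p q.
Proof.
by change (hdist (g * p)%g (g * q)%g = hdist p q); rewrite /hdist invgM -mulgA mulKg.
Qed.

Lemma hnorm_le p (s : R) : 0 <= s ->
  (xcoord p ^+ 2 + ycoord p ^+ 2) ^+ 2 + zcoord p ^+ 2 <= s ^+ 4 -> hnorm p <= s.
Proof.
by move=> s0; rewrite -hnorm4 ler_pXn2r ?nnegrE ?hnorm_ge0.
Qed.

Lemma hnorm_coord_le p (s : R) : 0 <= s -> hnorm p <= s ->
  [/\ `|xcoord p| <= s, `|ycoord p| <= s & `|zcoord p| <= s ^+ 2].
Proof.
move=> s0; rewrite -(@ler_pXn2r _ 4) ?nnegrE ?hnorm_ge0// hnorm4.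
case: p => x y z /=; rewrite (_ : s ^+ 4 = (s ^+ 2) ^+ 2); last by rewrite -exprM.
move=> xyz; have xy : x ^+ 2 + y ^+ 2 <= s ^+ 2.
  rewrite -(@ler_pXn2r _ 2) ?nnegrE ?addr_ge0 ?sqr_ge0//.
  by have := sqr_ge0 z; lra.
split; rewrite -(@ler_pXn2r _ 2) ?nnegrE ?normr_ge0 ?sqr_ge0// real_normK ?num_real//.
- by have := sqr_ge0 y; lra.
- by have := sqr_ge0 x; lra.
- by have := sqr_ge0 (x ^+ 2 + y ^+ 2); lra.
Qed.

Lemma grid_step (x c d : R) : 0 < d -> `|x| <= c ->
  exists i : 'I_(Num.truncn (2 * c / d)).+1, 0 <= x - (i%:R * d - c) <= d.
Proof.
move=> d0; rewrite ler_norml => /andP[cx xc].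
have xcd0 : 0 <= (x + c) / d by rewrite divr_ge0 ?(ltW d0)//; lra.
have ilt : (Num.truncn ((x + c) / d) < (Num.truncn (2 * c / d)).+1)%N.
  by rewrite ltnS le_truncn// ler_pM2r ?invr_gt0//; lra.
exists (Ordinal ilt) => /=; have /andP[] := truncn_itv xcd0.
set n := Num.truncn _.
by rewrite ler_pdivlMr// ltr_pdivrMr// -(natr1 n) mulrDl mul1r; lra.
Qed.

(** The point [(x, y, z)] is attached to the corner [(v, w)] of its square of
    side [d] in the horizontal grid.  Translating by [(v, w)] turns the height
    [z] into [z - 2 * (v * y - w * x)]; as [v * y - w * x] equals
    [v * (y - w) - w * (x - v)], this moves it by at most [4 * r.1 * d], so
    that heights remain within [M]. *)
Lemma closed_rectangle_sub_balls p (r : R * R) (d : R) : 0 < d -> d <= r.1 ->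
  let M := r.2 ^+ 2 + 4 * r.1 * d in
  let n := (Num.truncn (2 * r.1 / d)).+1 in
  let m := (Num.truncn (2 * M / d ^+ 2)).+1 in
  closed_rectangle p r `<=` \bigcup_(i : 'I_n * 'I_n * 'I_m)
    closed_mball (p * Heisenberg (i.1.1%:R * d - r.1) (i.1.2%:R * d - r.1)
                                (i.2%:R * d ^+ 2 - M))%g (2 * d).
Proof.
move=> d0 dr1 M n m q; rewrite closed_rectangleE => -[u [/=]].
case: u => x y z /=; rewrite !subr0 !mul0r subr0 mulr0 subr0 => xy zr <- {q}.
have r10 : 0 <= r.1 by rewrite (le_trans (ltW d0)).
have xr : `|x| <= r.1.
  rewrite -(@ler_pXn2r _ 2) ?nnegrE ?normr_ge0// real_normK ?num_real//.
  by have := sqr_ge0 y; lra.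
have yr : `|y| <= r.1.
  rewrite -(@ler_pXn2r _ 2) ?nnegrE ?normr_ge0// real_normK ?num_real//.
  by have := sqr_ge0 x; lra.
have [i /andP[xi0 xid]] := grid_step d0 xr.
have [j /andP[yj0 yjd]] := grid_step d0 yr.
set v := i%:R * d - r.1 in xi0 xid; set w := j%:R * d - r.1 in yj0 yjd.
have vr : `|v| <= r.1.
  move: xr; rewrite !ler_norml => /andP[x1 x2]; apply/andP; split; last by lra.
  by rewrite /v lerBrDr addNr mulr_ge0// ltW.
have wr : `|w| <= r.1.
  move: yr; rewrite !ler_norml => /andP[y1 y2]; apply/andP; split; last by lra.
  by rewrite /w lerBrDr addNr mulr_ge0// ltW.
have zM : `|z - 2 * (v * y - w * x)| <= M.
  have -> : v * y - w * x = v * (y - w) - w * (x - v) by ring.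
  have vyw : `|v * (y - w)| <= r.1 * d.
    by rewrite normrM ler_pM// ger0_norm.
  have wxv : `|w * (x - v)| <= r.1 * d.
    by rewrite normrM ler_pM// ger0_norm.
  move: vyw wxv zr; rewrite /M !ler_norml => /andP[? ?] /andP[? ?] /andP[? ?].
  by apply/andP; split; lra.
have [k /andP[zk0 zkd]] := grid_step (exprn_gt0 2 d0) zM.
exists (i, j, k) => //; rewrite /closed_mball /= -/v -/w mdist_mul2l.
change (hdist (Heisenberg v w (k%:R * d ^+ 2 - M)) (Heisenberg x y z) <= 2 * d).
apply: hnorm_le => /=; first by rewrite mulr_ge0// ltW.
set X := - v + x; set Y := - w + y; set Z := (_ + z + _).
have X2 : X ^+ 2 <= d ^+ 2 by rewrite ler_pXn2r ?nnegrE /X ?(ltW d0)//; lra.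
have Y2 : Y ^+ 2 <= d ^+ 2 by rewrite ler_pXn2r ?nnegrE /Y ?(ltW d0)//; lra.
have ZE : Z = z - 2 * (v * y - w * x) - (k%:R * d ^+ 2 - M) by rewrite /Z; ring.
have Z2 : Z ^+ 2 <= (d ^+ 2) ^+ 2 by rewrite ler_pXn2r ?nnegrE ?ZE ?sqr_ge0.
clearbody X Y Z.
have XY2 : (X ^+ 2 + Y ^+ 2) ^+ 2 <= (2 * d ^+ 2) ^+ 2.
  by rewrite ler_pXn2r ?nnegrE ?addr_ge0 ?sqr_ge0 ?mulr_ge0 ?sqr_ge0//; lra.
have -> : (2 * d) ^+ 4 = (2 * d ^+ 2) ^+ 2 + (d ^+ 2) ^+ 2 + 11 * (d ^+ 2) ^+ 2.
  by ring.
by have := sqr_ge0 (d ^+ 2); lra.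
Qed.

(** The grid has at most [3 * (r.1 / d)] steps in both horizontal directions
    and [9 * ((r.2 ^+ 2 + r.1 * d) / d ^+ 2)] in the vertical one: each count
    exceeds the length over the step by at most [1], and the assumption
    [d <= r.1] makes both quotients at least [1]. *)
Lemma hausdorff_content_rectangle_le (t : R) p (r : R * R) (d : R) :
  0 < t -> 0 < d -> d <= r.1 ->
  (hausdorff_content t (closed_rectangle p r) <=
   (81 * ((r.1 / d) ^+ 2 * ((r.2 ^+ 2 + r.1 * d) / d ^+ 2)) * (4 * d) `^ t)%:E)%E.
Proof.
move=> t0 d0 dr1; have r10 : 0 < r.1 := lt_le_trans d0 dr1.
apply: le_trans (hausdorff_content_le (D := 4 * d) t0
  (@closed_rectangle_sub_balls p r d d0 dr1) _) _.
  move=> i; apply: le_trans (diameter_closed_mball _ _) _.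
    by rewrite mulr_ge0// ltW.
  by rewrite lee_fin; lra.
rewrite lee_fin ler_wpM2r ?powR_ge0// !card_prod !card_ord !natrM.
set u := r.1 / d; set v := (r.2 ^+ 2 + r.1 * d) / d ^+ 2.
have u1 : 1 <= u by rewrite ler_pdivlMr// mul1r.
have d20 : 0 < d ^+ 2 by rewrite exprn_gt0.
have uv : u <= v.
  rewrite /u /v ler_pdivlMr// (_ : r.1 / d * d ^+ 2 = r.1 * d); last first.
    by field; rewrite gt_eqF.
  by rewrite lerDr sqr_ge0.
have n3 : (Num.truncn (2 * r.1 / d)).+1%:R <= 3 * u.
  have : (Num.truncn (2 * r.1 / d))%:R <= 2 * r.1 / d.
    by rewrite truncn_le divr_ge0 ?mulr_ge0// ltW.
  by rewrite -natr1 -mulrA -/u; lra.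
have m9 : (Num.truncn (2 * (r.2 ^+ 2 + 4 * r.1 * d) / d ^+ 2)).+1%:R <= 9 * v.
  have : (Num.truncn (2 * (r.2 ^+ 2 + 4 * r.1 * d) / d ^+ 2))%:R <=
      2 * (r.2 ^+ 2 + 4 * r.1 * d) / d ^+ 2.
    by rewrite truncn_le divr_ge0 ?mulr_ge0 ?addr_ge0 ?sqr_ge0 ?mulr_ge0// ltW.
  have : 2 * (r.2 ^+ 2 + 4 * r.1 * d) / d ^+ 2 <= 8 * v.
    rewrite /v mulrA ler_pM2r ?invr_gt0//.
    by have := sqr_ge0 r.2; lra.
  by rewrite -natr1; lra.
rewrite (_ : 81 * (u ^+ 2 * v) = 3 * u * (3 * u) * (9 * v)); last by ring.
by rewrite !ler_pM// mulr_ge0.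
Qed.

(** The grid requires [d <= r.1]; when the rectangle is taller than wide, a
    single ball of radius of order [r.2] covers it. *)
Lemma hausdorff_content_rectangle_le_height (t : R) p (r : R * R) :
  0 < t -> 0 < r.1 -> r.1 <= r.2 ->
  (hausdorff_content t (closed_rectangle p r) <= ((4 * r.2) `^ t)%:E)%E.
Proof.
move=> t0 r10 r12; have r20 : 0 < r.2 := lt_le_trans r10 r12.
have -> : (4 * r.2) `^ t = #|{: unit}|%:R * (4 * r.2) `^ t.
  by rewrite card_unit mul1r.
apply: (@hausdorff_content_le _ _ _ _ _ _ (fun=> closed_mball p (2 * r.2))) => //.
  move=> q; rewrite closed_rectangleE => -[[x y z] [/= xy zr] <- {q}].
  exists tt => //; rewrite /closed_mball/= -[X in mdist X](mulg1 p) mdist_mul2l.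
  change (hdist 1%g (Heisenberg x y z) <= 2 * r.2).
  rewrite /hdist invg1 mul1g; apply: hnorm_le => /=; first by rewrite mulr_ge0// ltW.
  move: xy zr; rewrite !subr0 !mul0r subr0 mulr0 subr0 => xy zr.
  have xy2 : (x ^+ 2 + y ^+ 2) ^+ 2 <= (r.2 ^+ 2) ^+ 2.
    rewrite ler_pXn2r ?nnegrE ?addr_ge0 ?sqr_ge0// (le_trans xy)//.
    by rewrite ler_pXn2r ?nnegrE// ltW.
  have z2 : z ^+ 2 <= (r.2 ^+ 2) ^+ 2.
    rewrite -(@real_normK _ z) ?num_real// ler_pXn2r ?nnegrE ?sqr_ge0//.
  have -> : (2 * r.2) ^+ 4 = (r.2 ^+ 2) ^+ 2 + (r.2 ^+ 2) ^+ 2 + 14 * (r.2 ^+ 2) ^+ 2.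
    by ring.
  by have := sqr_ge0 (r.2 ^+ 2); lra.
move=> _; apply: le_trans (diameter_closed_mball _ _) _.
  by rewrite mulr_ge0// ltW.
by rewrite lee_fin; lra.
Qed.

End heisenberg_cover.

(** * The uniform measure on the unit cube *)

Section product_bounds.
Context d1 d2 (T1 : measurableType d1) (T2 : measurableType d2) (R : realType).
Variables (m1 : {sigma_finite_measure set T1 -> \bar R})
          (m2 : {sigma_finite_measure set T2 -> \bar R}).

Lemma product_measure_xsection_le (X : set (T1 * T2)) (A : set T1) (a K : R) :
  measurable X -> measurable A -> 0 <= K -> (m1 A <= a%:E)%E ->
  (forall z, X z -> A z.1) ->
  (forall x, A x -> (m2 (xsection X x) <= K%:E)%E) ->
  ((m1 \x m2) X <= (a * K)%:E)%E.
Proof.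
move=> mX mA K0 m1A XA XK.
apply: (@le_trans _ _ (\int[m1]_x (K%:E * (\1_A x)%:E))%E).
  apply: le_ge0_integral => x /=; first exact: measure_ge0.
  rewrite indicE; have [xA|xA] := boolP (x \in A).
    by rewrite mule1; apply: XK; rewrite inE in xA.
  rewrite mule0 (_ : xsection X x = set0) ?measure0//.
  apply/seteqP; split => // y; rewrite /xsection/= inE => /XA /=.
  by move: xA; rewrite notin_setE.
rewrite ge0_integralZl//; last exact/measurable_EFinP/measurable_indic.
rewrite integral_indic ?setIT// mulrC EFinM.
by apply: lee_wpmul2l; rewrite ?lee_fin.
Qed.

End product_bounds.

Lemma product_measure_ysection_le d1 d2 (T1 : measurableType d1)
    (T2 : measurableType d2) (R : realType)
    (m1 : {sigma_finite_measure set T1 -> \bar R})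
    (m2 : {sigma_finite_measure set T2 -> \bar R})
    (X : set (T1 * T2)) (a K : R) :
  measurable X -> 0 <= K -> (m2 setT <= a%:E)%E ->
  (forall y, (m1 (ysection X y) <= K%:E)%E) ->
  ((m1 \x m2) X <= (a * K)%:E)%E.
Proof.
move=> mX K0 m2T XK.
rewrite (@product_measure_unique _ _ _ _ _ m1 m2 (m1 \x^ m2)%E)//; last first.
  by move=> A B mA mB; exact: product_measure2E.
apply: (@le_trans _ _ (\int[m2]_x K%:E)%E).
  by apply: le_ge0_integral => y /=; [exact: measure_ge0|exact: XK].
by rewrite integral_cst// mulrC EFinM; apply: lee_wpmul2l; rewrite ?lee_fin.
Qed.

Notation cube_space R := (measurableTypeR R * (measurableTypeR R * measurableTypeR R))%type.

Section uniform_cube.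
Context {R : realType}.

Definition unit_uniform : probability (measurableTypeR R) R := uniform_prob (@ltr01 R).

Definition cube_prob : probability (cube_space R) R :=
  (unit_uniform \x (unit_uniform \x unit_uniform))%E.

(** The constraints that a ball imposes on one parameter, the others being
    fixed, are all of this affine form. *)
Definition band (k c l : R) : set R := [set u | `|k * u - c| <= l].

Lemma bandE (k c l : R) : 0 < k -> band k c l = `[(c - l) / k, (c + l) / k]%classic.
Proof.
move=> k0; apply/seteqP; split => u; rewrite /band/= in_itv/= ler_pdivrMr// ler_pdivlMr//.
  by rewrite ler_norml => /andP[? ?]; apply/andP; split; lra.
by move=> /andP[? ?]; rewrite ler_norml; apply/andP; split; lra.
Qed.

Lemma measurable_band (k c l : R) : 0 < k -> measurable (band k c l).
Proof. by move=> k0; rewrite bandE. Qed.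

Lemma unit_uniform_band (k c l : R) : 0 < k -> 0 <= l ->
  (unit_uniform (band k c l) <= (2 * l / k)%:E)%E.
Proof.
move=> k0 l0; have mB := measurable_band c l k0.
apply: (@le_trans _ _ (lebesgue_measure (band k c l))).
  rewrite -[leRHS]mul1e -integral_cst//; apply: ge0_le_integral => //.
  - by move=> x _; rewrite lee_fin uniform_pdf_ge0.
  - apply/measurable_EFinP/measurable_funTS; exact: measurable_uniform_pdf.
  - by move=> x _; rewrite lee_fin /uniform_pdf subr0 invr1; case: ifP.
rewrite bandE// lebesgue_measure_itv/=; case: ifP => _.
  by rewrite lee_fin le_eqVlt; apply/orP; left; apply/eqP; field; rewrite gt_eqF.
by rewrite lee_fin divr_ge0 ?mulr_ge0// ltW.
Qed.

Lemma unit_uniform_le (E : set R) (k c l : R) : measurable E -> 0 < k -> 0 <= l ->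
  E `<=` band k c l -> (unit_uniform E <= (2 * l / k)%:E)%E.
Proof.
move=> mE k0 l0 EB; apply: le_trans (unit_uniform_band c k0 l0).
by apply: le_measure; rewrite ?inE//; exact: measurable_band.
Qed.

Definition unit_cube : set (cube_space R) :=
  `[0, 1]%classic `*` (`[0, 1]%classic `*` `[0, 1]%classic).

Lemma measurable_unit_cube : measurable unit_cube.
Proof. by apply: measurableX => //; exact: measurableX. Qed.

Lemma unit_uniform_itv : unit_uniform `[0, 1]%classic = 1%E.
Proof. exact: integral_uniform_pdf1. Qed.

Lemma cube_prob_unit_cube : cube_prob unit_cube = 1%E.
Proof.
pose I : set R := `[0, 1]%classic.
have mI : measurable (I : set (measurableTypeR R)) by exact: measurable_itv.
have I1 : unit_uniform I = 1%E := unit_uniform_itv.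
have square1 : (unit_uniform \x unit_uniform)%E
    (I `*` I) = 1%E.
  transitivity (unit_uniform I * unit_uniform I)%E.
    exact: product_measure1E.
  by rewrite I1 mule1.
transitivity (unit_uniform I *
    (unit_uniform \x unit_uniform)%E (I `*` I))%E.
  by apply: product_measure1E => //; exact: measurableX.
by rewrite I1 square1 mule1.
Qed.

(** The uniform measure ignores what lies outside of the cube; this lets the
    bounds below assume that parameters are in the unit interval. *)
Lemma cube_probIcube X : measurable X -> cube_prob (X `&` unit_cube) = cube_prob X.
Proof.
move=> mX; have mC := measurable_unit_cube.
have XC0 : cube_prob (X `\` unit_cube) = 0%E.
  apply/le_anti; rewrite measure_ge0 andbT.
  apply: (@le_trans _ _ (cube_prob (~` unit_cube))).
    by apply: le_measure; rewrite ?inE;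
      [exact: measurableD|exact: measurableC|move=> ? []].
  by rewrite probability_setC// cube_prob_unit_cube subee.
transitivity (cube_prob (X `\` unit_cube) + cube_prob (X `&` unit_cube))%E.
  by rewrite XC0 add0e.
exact/esym/measureDI.
Qed.

End uniform_cube.

(** * The chart of a rectangle *)

(** In a separable space an open set is a countable union of balls, so
    measurability for the Borel sets can be tested on distance functions. *)
Lemma measurable_fun_borel d (T : measurableType d) (R : realType)
    (X : pointedMetricType R) (q : nat -> X) (f : T -> borelType X) :
  (forall (x : X) e, 0 < e -> exists n, mdist (q n) x < e) ->
  (forall n, measurable_fun setT (fun u => mdist (q n) (f u : X))) ->
  measurable_fun setT f.
Proof.
move=> qdense mf; apply: (measurability (@open X : set (set (borelType X)))) => //.
move=> _ [U oU <-]; rewrite setTI.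
pose B n m := [set u : T | mdist (q n) (f u : X) <= m.+1%:R^-1 /\
  closed_mball (q n) m.+1%:R^-1 `<=` U].
rewrite (_ : f @^-1` U = \bigcup_n \bigcup_m B n m); last first.
  apply/seteqP; split => u /=; last first.
    by move=> [n _ [m _ [fu]]]; apply.
  move=> Ufu; have /nbhs_ballP[e /= e0 eU] : nbhs (f u : X) U.
    exact: open_nbhs_nbhs.
  pose m := Num.truncn (2 / e).
  have m2e : m.+1%:R^-1 < e / 2.
    rewrite -[ltRHS]invrK ltf_pV2 ?posrE ?invr_gt0 ?divr_gt0// invf_div.
    exact: truncnS_gt.
  have m0 : 0 < m.+1%:R^-1 :> R by rewrite invr_gt0.
  have [n qn] := qdense (f u) _ m0.
  exists n => //; exists m => //; split; first exact: ltW.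
  move=> y /= qy; apply: eU; rewrite ballEmdist/=.
  apply: le_lt_trans (metric_triangle (f u : X) (q n) y) _; rewrite metric_sym.
  by apply: lt_le_trans (ltr_leD qn qy) _; rewrite [leRHS]splitr lerD// ltW.
apply: bigcupT_measurable => n; apply: bigcupT_measurable => m.
have [BU|BU] := pselect (closed_mball (q n) m.+1%:R^-1 `<=` U); last first.
  by rewrite (_ : B n m = set0)//; apply/seteqP; split => // u [].
rewrite (_ : B n m = (fun u => mdist (q n) (f u : X)) @^-1` `]-oo, m.+1%:R^-1]).
  by rewrite -[X in measurable X]setTI; apply: mf.
by apply/seteqP; split => u /=; rewrite in_itv/= => //; case.
Qed.

Lemma measurable_coord1 (R : realType) : measurable_fun setT (fun u : cube_space R => u.1 : R).
Proof. exact: measurable_fst. Qed.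

Lemma measurable_coord2 (R : realType) : measurable_fun setT (fun u : cube_space R => u.2.1 : R).
Proof. exact: measurableT_comp. Qed.

Lemma measurable_coord3 (R : realType) : measurable_fun setT (fun u : cube_space R => u.2.2 : R).
Proof. exact: measurableT_comp. Qed.

Ltac measurable_polynomial :=
  repeat first [eassumption | exact: measurable_coord1 | exact: measurable_coord2
  | exact: measurable_coord3 | exact: measurable_cst | apply: measurable_funX
  | apply: measurable_funB | apply: measurable_funD | apply: measurable_funM].

Section rectangle_chart.
Context {R : realType}.
Local Notation H := (heisenberg R).
Implicit Types (p q : H) (r : R * R).

Definition rational_point (n : nat) : H :=
  if unpickle n is Some (a, b, c) then
    Heisenberg (ratr (a : rat)) (ratr (b : rat)) (ratr (c : rat))
  else 1%g.

Lemma rational_approx (x e : R) : 0 < e -> exists a : rat, `|x - ratr a| < e.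
Proof.
move=> e0; have /rat_in_itvoo[a] : x - e < x + e by lra.
rewrite in_itv/= => /andP[? ?]; exists a.
by rewrite ltr_norml; apply/andP; split; lra.
Qed.

Lemma rational_point_dense p (e : R) : 0 < e -> exists n, mdist (rational_point n) p < e.
Proof.
case: p => x y z e0; pose M := 1 + 2 * `|x| + 2 * `|y|.
have M1 : 1 <= M by have := normr_ge0 x; have := normr_ge0 y; rewrite /M; lra.
have M0 : 0 < M by lra.
pose s := Num.min 1 (e / 4).
have s0 : 0 < s by rewrite lt_min divr_gt0// ltr01.
have h0 : 0 < s ^+ 2 / M by rewrite divr_gt0// exprn_gt0.
have [a ax] := rational_approx x h0; have [b bx] := rational_approx y h0.
have [c cx] := rational_approx z h0.
exists (pickle (a, b, c)); rewrite /rational_point pickleK.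
change (hdist (Heisenberg (ratr a) (ratr b) (ratr c)) (Heisenberg x y z) < e).
have se : 4 * s <= e by rewrite -ler_pdivlMl// mulrC ge_min lexx orbT.
have s1 : s <= 1 by rewrite ge_min lexx.
apply: le_lt_trans (_ : 2 * s < e); last by lra.
rewrite /hdist; apply: hnorm_le => /=; first by rewrite mulr_ge0// ltW.
set X := - ratr a + x; set Y := - ratr b + y; set Z := (_ + z + _).
have h2 : s ^+ 2 / M <= s ^+ 2 by rewrite ler_pdivrMr// ler_peMr// sqr_ge0.
have s2s : s ^+ 2 <= s by rewrite expr2 ler_piMl// ltW.
have XX : `|X| <= s ^+ 2 / M by rewrite /X addrC ltW.
have YY : `|Y| <= s ^+ 2 / M by rewrite /Y addrC ltW.
have ZZ : `|Z| <= s ^+ 2.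
  have -> : Z = (z - ratr c) + (2 * y * X - 2 * x * Y) by rewrite /Z /X /Y; ring.
  apply: le_trans (ler_normD _ _) _; apply: le_trans (lerD (ltW cx) (ler_normB _ _)) _.
  rewrite !normrM (ger0_norm (ler0n R 2)).
  have xY : `|x| * `|Y| <= `|x| * (s ^+ 2 / M) by rewrite ler_wpM2l.
  have yX : `|y| * `|X| <= `|y| * (s ^+ 2 / M) by rewrite ler_wpM2l.
  rewrite -[leRHS](@divfK _ M _ (s ^+ 2)) ?gt_eqF//.
  move: xY yX; set h := s ^+ 2 / M; rewrite /M => xY yX; lra.
have X2 : X ^+ 2 <= s ^+ 2.
  by rewrite -(@real_normK _ X) ?num_real// ler_pXn2r ?nnegrE ?(ltW s0)//; lra.
have Y2 : Y ^+ 2 <= s ^+ 2.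
  by rewrite -(@real_normK _ Y) ?num_real// ler_pXn2r ?nnegrE ?(ltW s0)//; lra.
have Z2 : Z ^+ 2 <= (s ^+ 2) ^+ 2.
  by rewrite -(@real_normK _ Z) ?num_real// ler_pXn2r ?nnegrE ?sqr_ge0.
clearbody X Y Z.
have XY2 : (X ^+ 2 + Y ^+ 2) ^+ 2 <= (2 * s ^+ 2) ^+ 2.
  by rewrite ler_pXn2r ?nnegrE ?addr_ge0 ?sqr_ge0 ?mulr_ge0 ?sqr_ge0//; lra.
have -> : (2 * s) ^+ 4 = (2 * s ^+ 2) ^+ 2 + (s ^+ 2) ^+ 2 + 11 * (s ^+ 2) ^+ 2.
  by ring.
by have := sqr_ge0 (s ^+ 2); lra.
Qed.

Lemma measurable_fun_heisenberg d (T : measurableType d) (f : T -> borelType H) :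
  measurable_fun setT (fun u => xcoord (f u)) ->
  measurable_fun setT (fun u => ycoord (f u)) ->
  measurable_fun setT (fun u => zcoord (f u)) ->
  measurable_fun setT f.
Proof.
move=> mx my mz; apply: (measurable_fun_borel rational_point_dense) => n.
move: (rational_point n) => q.
change (measurable_fun setT (fun u => hnorm (q^-1 * (f u : H))%g)).
apply: (measurableT_comp (measurable_powR _)) => /=.
by measurable_polynomial.
Qed.

(** On the unit cube the first coordinate [x] of the right factor runs between
    [r.1 / 2] and [3 * r.1 / 4], and the second is [x * m] for a slope [m]
    between [0] and [1 / 2].  With slopes, the twist relative to a fixed centre
    depends on [m] through a term [x' * x * m], with [x'] the first coordinate
    of the centre; if [x'] is of order [r.1], a height constraint of order
    [s ^+ 2] then confines [m] to a range of order [s ^+ 2 / r.1 ^+ 2]. *)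
Definition rectangle_chart p r (u : cube_space R) : borelType H :=
  (p * Heisenberg (r.1 * (1 / 2 + u.1 / 4)) (r.1 * (1 / 2 + u.1 / 4) * (u.2.1 / 2))
                  (r.2 ^+ 2 * u.2.2))%g.

Lemma measurable_rectangle_chart p r : measurable_fun setT (rectangle_chart p r).
Proof.
by apply: measurable_fun_heisenberg => /=; measurable_polynomial.
Qed.

HB.instance Definition _ p r := isMeasurableFun.Build _ _ _ _
  (rectangle_chart p r) (measurable_rectangle_chart p r).

Definition rectangle_prob p r : probability (borelType H) R :=
  distribution cube_prob (rectangle_chart p r).

End rectangle_chart.

(** * Measure of the balls *)

Section rectangle_prob_bounds.
Context {R : realType}.
Local Notation H := (heisenberg R).
Implicit Types (p q : H) (r : R * R).

Lemma rectangle_prob_rectangle p r : 0 < r.1 -> 0 < r.2 ->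
  rectangle_prob p r (closed_rectangle p r) = 1%E.
Proof.
move=> r10 r20; pose D := rectangle_chart p r @^-1` closed_rectangle p r.
pose F (u : cube_space R) : R :=
  (r.1 * (1 / 2 + u.1 / 4)) ^+ 2 + (r.1 * (1 / 2 + u.1 / 4) * (u.2.1 / 2)) ^+ 2.
pose G (u : cube_space R) : R := `|r.2 ^+ 2 * u.2.2|.
have DE : D = F @^-1` `]-oo, r.1 ^+ 2] `&` G @^-1` `]-oo, r.2 ^+ 2].
  rewrite /D closed_rectangleE.
  apply/seteqP; split => u; rewrite /F /G /setI/= !in_itv/=.
    case=> v [/= v1 v2] /(congr1 (fun s => p^-1 * s)%g); rewrite !mulKg => vE.
    by move: v1 v2; rewrite vE /= !subr0 !mul0r subr0 mulr0 subr0.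
  move=> [u1 u2]; eexists; last by reflexivity.
  by rewrite /closed_rectangle/= !subr0 !mul0r subr0 mulr0 subr0.
have mD : measurable D.
  rewrite DE; apply: measurableI; rewrite -[X in measurable X]setTI.
    suff mF : measurable_fun setT F by exact: mF.
    by measurable_polynomial.
  suff mG : measurable_fun setT G by exact: mG.
  apply: measurableT_comp => //.
  by measurable_polynomial.
change (cube_prob D = 1%E); apply/le_anti.
rewrite probability_le1//= -[leLHS]cube_prob_unit_cube.
apply: le_measure; rewrite ?inE//; first exact: measurable_unit_cube.
rewrite DE => -[a [b c]] [/=]; rewrite !in_itv/= => /andP[a0 a1] [/andP[b0 b1] /andP[c0 c1]].
split; rewrite /F /G /= ?in_itv/=.
  set x := _ * (1 / 2 + _); have x0 : 0 <= x by rewrite /x mulr_ge0 ?(ltW r10)//; lra.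
  have x34 : x <= 3 / 4 * r.1 by rewrite /x mulrC ler_pM2r//; lra.
  have xb : x * (b / 2) <= x / 2 by rewrite ler_wpM2l//; lra.
  have x2 : x ^+ 2 <= (3 / 4 * r.1) ^+ 2.
    by rewrite ler_pXn2r ?nnegrE ?mulr_ge0 ?(ltW r10)//; lra.
  have xb2 : (x * (b / 2)) ^+ 2 <= (x / 2) ^+ 2.
    by rewrite ler_pXn2r ?nnegrE ?mulr_ge0 ?divr_ge0//; lra.
  have r12 := sqr_ge0 r.1.
  clearbody x; apply: le_trans (lerD x2 xb2) _.
  rewrite (_ : (x / 2) ^+ 2 = x ^+ 2 / 4); last by field.
  have -> : (3 / 4 * r.1) ^+ 2 = 9 / 16 * r.1 ^+ 2 by field.
  move: x2; have -> : (3 / 4 * r.1) ^+ 2 = 9 / 16 * r.1 ^+ 2 by field.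
  lra.
have r220 := sqr_ge0 r.2; rewrite ger0_norm; last exact: mulr_ge0.
by rewrite ler_piMr.
Qed.

Definition chart_ball r q s :=
  (rectangle_chart 1%g r @^-1` closed_mball q s) `&` unit_cube.

Lemma measurable_chart_ball r q s : measurable (chart_ball r q s).
Proof.
apply: measurableI; last exact: measurable_unit_cube.
rewrite -[X in measurable X]setTI.
by apply: measurable_rectangle_chart => //; exact: measurable_closed_mball.
Qed.

Lemma rectangle_prob_ball p r q s :
  rectangle_prob p r (closed_mball q s) = cube_prob (chart_ball r (p^-1 * q)%g s).
Proof.
rewrite cube_probIcube; last first.
  rewrite -[X in measurable X]setTI.
  by apply: measurable_rectangle_chart => //; exact: measurable_closed_mball.
change (cube_prob (rectangle_chart p r @^-1` closed_mball q s) =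
  cube_prob (rectangle_chart 1%g r @^-1` closed_mball (p^-1 * q)%g s)).
have pqE (h : H) : mdist q (p * h)%g = mdist (p^-1 * q)%g h.
  by rewrite -[X in mdist X _](mulVKg p q) mdist_mul2l.
congr (cube_prob _); apply/seteqP; split => u;
  by rewrite /closed_mball /rectangle_chart/= mul1g pqE.
Qed.

(** The five facts from which all measure bounds follow.  The third and the
    last both constrain the slope parameter [b]: the third comes from the
    second coordinate and is linear in [s]; the last comes from the height, is
    quadratic in [s], and is of use when [xcoord q] is comparable to [r.1]. *)
Lemma chart_ballP r q s a b c : 0 < r.1 -> 0 < s ->
  chart_ball r q s (a, (b, c)) ->
  let x := r.1 * (1 / 2 + a / 4) in
  [/\ r.1 / 2 <= x, band (r.1 / 4) (xcoord q - r.1 / 2) s a,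
      band (x / 2) (ycoord q) s b,
      band (r.2 ^+ 2) (zcoord q +
        2 * (xcoord q * (x * (b / 2)) - ycoord q * x)) (s ^+ 2) c &
      band (xcoord q * x) (r.2 ^+ 2 * c - zcoord q + 2 * ycoord q * x) (s ^+ 2) b].
Proof.
move=> r10 s0 [qu [/=]]; rewrite in_itv/= => /andP[a0 a1] _.
set x := r.1 * (1 / 2 + a / 4).
have : hnorm (q^-1 * Heisenberg x (x * (b / 2)) (r.2 ^+ 2 * c))%g <= s.
  by move: qu; rewrite /closed_mball /rectangle_chart/= mul1g.
case/(hnorm_coord_le (ltW s0)); case: q {qu} => qx qy qz /= X Y Z.
split; rewrite /band /=.
- by rewrite /x ler_pM2l//; lra.
- by apply: le_trans X; rewrite le_eqVlt; apply/orP; left; apply/eqP; congr `|_|;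
    rewrite /x; field.
- by apply: le_trans Y; rewrite le_eqVlt; apply/orP; left; apply/eqP; congr `|_|; field.
- by apply: le_trans Z; rewrite le_eqVlt; apply/orP; left; apply/eqP; congr `|_|; ring.
- rewrite -normrN; apply: le_trans Z; rewrite le_eqVlt; apply/orP; left; apply/eqP.
  by congr `|_|; field.
Qed.

(** Only the constraint on the height is used: for fixed [a] and [b], it
    confines [c] to an interval of length [2 * s ^+ 2 / r.2 ^+ 2]. *)
Lemma chart_ball_le_exp2 r q (s : R) : 0 < r.1 -> 0 < r.2 -> 0 < s ->
  (cube_prob (chart_ball r q s) <= (2 / r.2 ^+ 2 * s ^+ 2)%:E)%E.
Proof.
move=> r10 r20 s0; have mB := measurable_chart_ball r q s.
have r220 : 0 < r.2 ^+ 2 by rewrite exprn_gt0.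
have K0 : 0 <= 2 / r.2 ^+ 2 * s ^+ 2 by rewrite mulr_ge0 ?sqr_ge0// divr_ge0// ltW.
rewrite -[X in X%:E]mul1r; apply: (product_measure_xsection_le (A := setT)) => //.
  exact: probability_le1.
move=> a _; rewrite -[X in X%:E]mul1r; apply: (product_measure_xsection_le (A := setT)) => //.
- exact: measurable_xsection.
- exact: probability_le1.
move=> b _; rewrite mulrAC.
apply: (@unit_uniform_le _ _ (r.2 ^+ 2) (zcoord q + 2 * (xcoord q *
   (r.1 * (1 / 2 + a / 4) * (b / 2)) - ycoord q * (r.1 * (1 / 2 + a / 4)))) (s ^+ 2)) => //.
- by do 2 apply: measurable_xsection.
- exact: sqr_ge0.
by move=> c; rewrite /xsection/= !inE/= inE/= => /(chart_ballP r10 s0)[].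
Qed.

Lemma chart_ball_le_slice r q (s K : R) : 0 < r.1 -> 0 < s -> 0 <= K ->
  (forall a, r.1 / 2 <= r.1 * (1 / 2 + a / 4) ->
    ((unit_uniform \x unit_uniform) (xsection (chart_ball r q s) a) <= K%:E)%E) ->
  (cube_prob (chart_ball r q s) <= (8 * s / r.1 * K)%:E)%E.
Proof.
move=> r10 s0 K0 slice; have mB := measurable_chart_ball r q s.
have r40 : 0 < r.1 / 4 by rewrite divr_gt0.
have -> : 8 * s / r.1 = 2 * s / (r.1 / 4) by field; rewrite gt_eqF.
apply: (product_measure_xsection_le
  (A := (`[0, 1]%classic `&` band (r.1 / 4) (xcoord q - r.1 / 2) s
    : set (measurableTypeR R)))) => //.
- by apply: measurableI => //; exact: measurable_band.
- apply: (@unit_uniform_le _ _ _ (xcoord q - r.1 / 2) _ _ r40 (ltW s0)); last by move=> a' [].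
  by apply: measurableI => //; exact: measurable_band.
- move=> [a [b c]] B; split; first by case: B => _ [].
  by case: (chart_ballP r10 s0 B).
move=> a [/=]; rewrite in_itv/= => /andP[a0 a1] _; apply: slice.
by rewrite ler_pM2l//; lra.
Qed.

(** The parameters [a] and [b] range in intervals of length at most
    [8 * s / r.1] and then [c] in one of length [2 * s ^+ 2 / r.2 ^+ 2]; the
    product is proportional to the Haar measure of a ball. *)
Lemma chart_ball_le_exp4 r q (s : R) : 0 < r.1 -> 0 < r.2 -> 0 < s ->
  (cube_prob (chart_ball r q s) <= (128 / (r.1 ^+ 2 * r.2 ^+ 2) * s ^+ 4)%:E)%E.
Proof.
move=> r10 r20 s0; have mB := measurable_chart_ball r q s.
have r220 : 0 < r.2 ^+ 2 by rewrite exprn_gt0.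
have K0 : 0 <= 2 * s ^+ 2 / r.2 ^+ 2.
  by rewrite divr_ge0 ?(ltW r220)// mulr_ge0// sqr_ge0.
have -> : 128 / (r.1 ^+ 2 * r.2 ^+ 2) * s ^+ 4 =
    8 * s / r.1 * (8 * s / r.1 * (2 * s ^+ 2 / r.2 ^+ 2)).
  by field; rewrite !gt_eqF.
apply: chart_ball_le_slice => // [|a].
  by rewrite mulr_ge0// divr_ge0 ?mulr_ge0// ltW.
set x := r.1 * (1 / 2 + a / 4) => rx; have x0 : 0 < x / 2 by lra.
apply: (product_measure_xsection_le
  (A := (band (x / 2) (ycoord q) s : set (measurableTypeR R)))) => //.
- exact: measurable_xsection.
- exact: measurable_band.
- apply: le_trans (unit_uniform_band _ x0 (ltW s0)) _.
  rewrite lee_fin ler_pdivrMr// -(ler_pM2r r10).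
  have -> : 8 * s / r.1 * (x / 2) * r.1 = 2 * (s * (2 * x)).
    by field; rewrite gt_eqF.
  by rewrite -mulrA ler_pM2l// ler_pM2l//; lra.
- by move=> [b c]; rewrite /xsection/= inE => /(chart_ballP r10 s0)[].
move=> b _.
apply: (@unit_uniform_le _ _ _ (zcoord q + 2 * (xcoord q *
   (x * (b / 2)) - ycoord q * x))) => //.
- by do 2 apply: measurable_xsection.
- exact: sqr_ge0.
by move=> c; rewrite /xsection/= !inE/= inE/= => /(chart_ballP r10 s0)[].
Qed.

(** The slope is integrated before the height, which is allowed by Fubini's
    theorem: for fixed [a] and [c], the height constraint confines [b] to an
    interval of length of order [s ^+ 2 / r.1 ^+ 2]. *)
Lemma chart_ball_le_exp3 r q (s : R) : 0 < r.1 -> 0 < s ->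
  (cube_prob (chart_ball r q s) <= (128 / r.1 ^+ 3 * s ^+ 3)%:E)%E.
Proof.
move=> r10 s0; have mB := measurable_chart_ball r q s.
have r130 : 0 < r.1 ^+ 3 by rewrite exprn_gt0.
have r120 : 0 < r.1 ^+ 2 by rewrite exprn_gt0.
(* For such large [s] the trivial bound [1] is enough; otherwise a ball that
   meets the chart has a centre with first coordinate at least [r.1 / 4]. *)
have [r4s|sr4] := leP (r.1 / 4) s.
  apply: le_trans (probability_le1 _ mB) _.
  rewrite lee_fin mulrAC ler_pdivlMr// mul1r.
  apply: (@le_trans _ _ (128 * (r.1 / 4) ^+ 3)).
    by rewrite expr_div_n; lra.
  by rewrite ler_pM2l// ler_pXn2r// nnegrE ?divr_ge0// ltW.
have [xr4|r4x] := ltP (xcoord q) (r.1 / 4).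
  rewrite (_ : chart_ball r q s = set0).
    by rewrite measure0 lee_fin mulr_ge0 ?divr_ge0 ?exprn_ge0// ltW.
  apply/seteqP; split => // -[a [b c]] /(chart_ballP r10 s0)[+ + _ _ _].
  rewrite /band/= ler_norml => ? /andP[? ?]; lra.
have K0 : 0 <= 16 * s ^+ 2 / r.1 ^+ 2.
  by rewrite divr_ge0 ?(ltW r120)// mulr_ge0// sqr_ge0.
have -> : 128 / r.1 ^+ 3 * s ^+ 3 = 8 * s / r.1 * (16 * s ^+ 2 / r.1 ^+ 2).
  by field; rewrite !gt_eqF.
apply: chart_ball_le_slice => // a.
set x := r.1 * (1 / 2 + a / 4) => rx.
have qx : r.1 ^+ 2 / 8 <= xcoord q * x.
  rewrite (_ : r.1 ^+ 2 / 8 = r.1 / 4 * (r.1 / 2)); last by field.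
  by rewrite ler_pM ?divr_ge0// ltW.
have qx0 : 0 < xcoord q * x by rewrite (lt_le_trans _ qx)// divr_gt0.
rewrite -[X in X%:E]mul1r; apply: product_measure_ysection_le => //.
- exact: measurable_xsection.
- exact: probability_le1.
move=> c; apply: (@le_trans _ _ (2 * s ^+ 2 / (xcoord q * x))%:E).
  apply: (@unit_uniform_le _ _ _ (r.2 ^+ 2 * c - zcoord q + 2 * ycoord q * x)) => //.
  - by apply: measurable_ysection; exact: measurable_xsection.
  - exact: sqr_ge0.
  by move=> b; rewrite /ysection /xsection/= !inE/= inE/= => /(chart_ballP r10 s0)[].
rewrite lee_fin ler_pdivrMr//.
apply: (@le_trans _ _ (16 * s ^+ 2 / r.1 ^+ 2 * (r.1 ^+ 2 / 8))).
  rewrite (_ : 16 * s ^+ 2 / r.1 ^+ 2 * (r.1 ^+ 2 / 8) = 2 * s ^+ 2)//.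
  by field; rewrite gt_eqF.
by rewrite ler_wpM2l.
Qed.

End rectangle_prob_bounds.

(** * Comparison at the natural scale *)

Section bounds_at_scale.
Context {R : realType}.

(** Both inequalities reduce to the data of a scale [d] and a number [W] of
    balls: [W] bounds the covering number, and [1 / W] the measure of the
    balls of radius [d], up to constants.  The numbers [162] and [256] are the
    largest constants that the four regimes require. *)
Lemma bounds_at_scale (t : R) (a b : nat) (p : heisenberg R) (r : R * R)
    (d W K1 K2 c : R) :
  b%:R < t -> t < a%:R -> 0 < t -> 0 < r.1 -> 0 < r.2 ->
  0 < d -> 0 < W -> 0 < K1 -> 0 < K2 ->
  162 * 4 `^ t <= c -> 256 * scale_constant t a b <= c ->
  (hausdorff_content t (closed_rectangle p r) <= (162 * W * (4 * d) `^ t)%:E)%E ->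
  (forall q s, 0 < s ->
    (rectangle_prob p r (closed_mball q s) <= (K1 * s ^+ a)%:E)%E) ->
  (forall q s, 0 < s ->
    (rectangle_prob p r (closed_mball q s) <= (K2 * s ^+ b)%:E)%E) ->
  (K1 * d ^+ a + K2 * d ^+ b) * W <= 256 ->
  directed_singular_value t r = W * d `^ t ->
  ((c^-1)%:E * hausdorff_content t (closed_rectangle p r)
     <= (directed_singular_value t r)%:E)%E /\
  ((directed_singular_value t r)%:E
     <= c%:E * capacity t (closed_rectangle p r))%E.
Proof.
move=> bt ta t0 r10 r20 d0 W0 K10 K20 c4 cC cont muK1 muK2 SW ->.
have C0 := scale_constant_gt0 bt ta.
have c0 : 0 < c by rewrite (lt_le_trans _ cC)// mulr_gt0.
have D0 : 0 < d `^ t by rewrite powR_gt0.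
split.
  rewrite lee_pdivrMl// (le_trans cont)// -EFinM lee_fin powRM ?(ltW d0)//.
  rewrite (_ : 162 * W * (4 `^ t * d `^ t) = 162 * 4 `^ t * (W * d `^ t)); last by ring.
  by rewrite ler_pM2r// mulr_gt0.
have := capacity_ge t0 bt ta d0 K10 K20 (rectangle_prob_rectangle p r10 r20) muK1 muK2.
set S := K1 * d ^+ a + K2 * d ^+ b in SW *.
have S0 : 0 < S by rewrite addr_gt0// mulr_gt0// exprn_gt0.
move=> /(lee_wpmul2l (_ : 0 <= c%:E)%E); rewrite lee_fin => /(_ (ltW c0)).
apply: le_trans; rewrite -EFinM lee_fin mulrA ler_pdivlMr ?mulr_gt0//.
rewrite (_ : W * d `^ t * (scale_constant t a b * S) =
  S * W * scale_constant t a b * d `^ t); last by ring.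
by rewrite ler_pM2r// (le_trans _ cC)// ler_pM2r.
Qed.

Lemma rectangle_prob_ball_le1 (p : heisenberg R) r q (s : R) :
  (rectangle_prob p r (closed_mball q s) <= (1 * s ^+ 0)%:E)%E.
Proof. by rewrite expr0 mulr1; apply: probability_le1; exact: measurable_closed_mball. Qed.

End bounds_at_scale.

Theorem proposition1p2 (R : realType) (t : R) (t_gt0 : 0 < t) (t_lt4 : t < 4)
    (t_neq1 : t != 1) (t_neq2 : t != 2) (t_neq3 : t != 3) :
  exists c : R, 0 < c /\
    forall (p : heisenberg R) (r : R * R), 0 < r.1 -> 0 < r.2 ->
      ((c^-1)%:E * hausdorff_content t (closed_rectangle p r)
         <= (directed_singular_value t r)%:E)%E /\
      ((directed_singular_value t r)%:E
         <= c%:E * capacity t (closed_rectangle p r))%E.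
Proof.
pose Ctall := if t < 2 then scale_constant t 2%N 0%N else scale_constant t 4%N 2%N.
pose Cflat := if t < 3 then scale_constant t 3%N 0%N else scale_constant t 4%N 3%N.
have Ctall0 : 0 < Ctall.
  rewrite /Ctall; case: (ltP t 2) => t2; apply: scale_constant_gt0 => //.
  by rewrite lt_def t_neq2.
have Cflat0 : 0 < Cflat.
  rewrite /Cflat; case: (ltP t 3) => t3; apply: scale_constant_gt0 => //.
  by rewrite lt_def t_neq3.
have T0 : 0 < 4 `^ t :> R by rewrite powR_gt0.
pose c := 162 * 4 `^ t + 256 * Ctall + 256 * Cflat.
have cT : 162 * 4 `^ t <= c by rewrite /c; lra.
have ctall : 256 * Ctall <= c by rewrite /c; lra.
have cflat : 256 * Cflat <= c by rewrite /c; lra.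
exists c; split; first by rewrite /c; lra.
clearbody c => p r r10 r20.
have r120 : 0 < r.1 ^+ 2 by rewrite exprn_gt0.
have r220 : 0 < r.2 ^+ 2 by rewrite exprn_gt0.
have r130 : 0 < r.1 ^+ 3 by rewrite exprn_gt0.
have [r12|r21] := leP r.1 r.2.
  rewrite /Ctall in ctall Ctall0; move: ctall.
  have r12_2 : r.1 ^+ 2 <= r.2 ^+ 2 by rewrite ler_pXn2r ?nnegrE// ltW.
  case: (ltP t 2) => t2 ctall.
    apply: (@bounds_at_scale _ t 2%N 0%N p r r.2 1 (2 / r.2 ^+ 2) 1) => //.
    - by rewrite divr_gt0.
    - apply: le_trans (hausdorff_content_rectangle_le_height p t_gt0 r10 r12) _.
      by rewrite lee_fin; have := powR_ge0 (4 * r.2) t; lra.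
    - by move=> q s s0; rewrite rectangle_prob_ball; exact: chart_ball_le_exp2.
    - by move=> q s _; exact: rectangle_prob_ball_le1.
    - by rewrite divfK ?gt_eqF// expr0; lra.
    - by rewrite /directed_singular_value r12 ltW// mul1r.
  have {}t2 : 2 < t by rewrite lt_def t_neq2.
  apply: (@bounds_at_scale _ t 4%N 2%N p r r.1 (r.2 ^+ 2 / r.1 ^+ 2)
    (128 / (r.1 ^+ 2 * r.2 ^+ 2)) (2 / r.2 ^+ 2)) => //.
  - by rewrite divr_gt0.
  - by rewrite divr_gt0// mulr_gt0.
  - by rewrite divr_gt0.
  - apply: le_trans (hausdorff_content_rectangle_le p t_gt0 r10 (lexx _)) _.
    rewrite lee_fin ler_wpM2r ?powR_ge0// divff ?gt_eqF// expr1n mul1r.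
    by rewrite !mulrA ler_pM2r ?invr_gt0//; lra.
  - by move=> q s s0; rewrite rectangle_prob_ball; exact: chart_ball_le_exp4.
  - by move=> q s s0; rewrite rectangle_prob_ball; exact: chart_ball_le_exp2.
  - rewrite (_ : _ * _ = 130); first by lra.
    by field; rewrite !gt_eqF.
  - rewrite /directed_singular_value r12 leNgt t2/= powRB ?gt_eqF ?implybT//.
    by rewrite powR_mulrn ?(ltW r10)//; field; rewrite gt_eqF.
rewrite /Cflat in cflat Cflat0; move: cflat.
have r21_2 : r.2 ^+ 2 <= r.1 ^+ 2 by rewrite ler_pXn2r ?nnegrE// ltW.
case: (ltP t 3) => t3 cflat.
  apply: (@bounds_at_scale _ t 3%N 0%N p r r.1 1 (128 / r.1 ^+ 3) 1) => //.
  - by rewrite divr_gt0.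
  - apply: le_trans (hausdorff_content_rectangle_le p t_gt0 r10 (lexx _)) _.
    rewrite lee_fin ler_wpM2r ?powR_ge0// divff ?gt_eqF// expr1n mul1r.
    by rewrite mulrA ler_pdivrMr//; lra.
  - by move=> q s s0; rewrite rectangle_prob_ball; exact: chart_ball_le_exp3.
  - by move=> q s _; exact: rectangle_prob_ball_le1.
  - by rewrite divfK ?gt_eqF// expr0; lra.
  - by rewrite /directed_singular_value leNgt r21/= ltW// mul1r.
have {}t3 : 3 < t by rewrite lt_def t_neq3.
have d0 : 0 < r.2 ^+ 2 / r.1 by rewrite divr_gt0.
apply: (@bounds_at_scale _ t 4%N 3%N p r (r.2 ^+ 2 / r.1) ((r.1 / r.2) ^+ 6)
  (128 / (r.1 ^+ 2 * r.2 ^+ 2)) (128 / r.1 ^+ 3)) => //.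
- by rewrite exprn_gt0// divr_gt0.
- by rewrite divr_gt0// mulr_gt0.
- by rewrite divr_gt0.
- apply: le_trans (hausdorff_content_rectangle_le p t_gt0 d0 _) _.
    by rewrite ler_pdivrMr.
  rewrite lee_fin ler_wpM2r ?powR_ge0// le_eqVlt; apply/orP; left; apply/eqP.
  by field; rewrite !gt_eqF.
- by move=> q s s0; rewrite rectangle_prob_ball; exact: chart_ball_le_exp4.
- by move=> q s s0; rewrite rectangle_prob_ball; exact: chart_ball_le_exp3.
- rewrite (_ : _ * _ = 256)//.
  by field; rewrite !gt_eqF.
- have [r1n0 r2n0] : r.1 != 0 /\ r.2 != 0 by rewrite !gt_eqF.
  rewrite /directed_singular_value leNgt r21/= leNgt t3/=.
  rewrite powRB ?r1n0 ?implybT// powRM ?(ltW r220) ?invr_ge0 ?(ltW r10)//.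
  rewrite (_ : 2 * (t - 3) = 2%:R * t - 6%:R); last by ring.
  rewrite powRB ?r2n0 ?implybT// powRrM !powR_mulrn ?(ltW r10) ?(ltW r20)//.
  rewrite -[r.1^-1]powR_inv1 ?(ltW r10)// -powRrM mulN1r powRN.
  by field; rewrite !gt_eqF ?powR_gt0.
Qed.
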